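(* Let $r$ be an odd positive integer and let $p>1$ be an integer with $p\mid r$. For $n\ge 0$ let $f_{r,p,n}(u,v,w)=\sum_{\pi\in I_{r,p,n}}u^{\mathrm{fix}(\pi)}v^{\mathrm{exc}_A(\pi)}w^{\mathrm{csum}(\pi)}$. Then for all $n\ge1$ $$f_{r,p,n}(u,v,w)=u\,f_{r,p,n-1}(u,v,w)+(n-1)\left(v+(r-1)w^{r}\right)f_{r,p,n-2}(u,v,w),$$ and $$f_{r,p,n}(u,v,w)=\sum_{j=\lceil n/2\rceil}^n(n-j)!\binom{n}{n-j,\ n-j,\ 2j-n}\frac{u^{2j-n}\left(v+(r-1)w^r\right)^{n-j}}{2^{n-j}}.$$
   Context: Let $\Sigma=\{i^{[c]} : 1\le i\le n,\ c\in\mathbb{Z}_r\}$ be the set $[n]=\{1,\dots,n\}$ coloured with colours $0,1,\dots,r-1$; write $i$ for $i^{[0]}$. The group $G_{r,n}=\mathbb{Z}_r\wr S_n$ of coloured permutations consists, under composition, of all bijections $\sigma:\Sigma\to\Sigma$ for which there are a permutation $|\sigma|\in S_n$ and integers $z_1(\sigma),\dots,z_n(\sigma)\in\{0,\dots,r-1\}$ with $\sigma(i^{[c]})=(|\sigma|(i))^{[c+z_i(\sigma)]}$ (colours added modulo $r$). Put $\mathrm{csum}(\sigma)=\sum_{i=1}^n z_i(\sigma)$, an integer. For $p\mid r$, $G_{r,p,n}=\{\sigma\in G_{r,n} : \mathrm{csum}(\sigma)\equiv 0 \bmod p\}$, and $I_{r,p,n}$ is the set of its involutions, i.e. elements $\pi$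 with $\pi^2=1$ (the identity included). By convention $f_{r,p,0}=1$ and $f_{r,p,-1}=0$. The colour order on $\Sigma$ is $1^{[r-1]}<\cdots<n^{[r-1]}<1^{[r-2]}<\cdots<n^{[r-2]}<\cdots<1<\cdots<n$. Define $\mathrm{exc}_A(\sigma)=|\{i\in[n-1] : \sigma(i)>i\}|$ (comparison in the colour order). $\mathrm{fix}(\sigma)$ denotes the number of absolute fixed points, i.e. of $i\in[n]$ with $|\sigma|(i)=i$. Multinomial coefficients: $\binom{n}{a,b,c}=\frac{n!}{a!\,b!\,c!}$. *)

(* Defs.v *)
From mathcomp Require Import all_boot all_order all_fingroup all_algebra.
From mathcomp Require Import mpoly.

Set Implicit Arguments.
Unset Strict Implicit.
Unset Printing Implicit Defensive.

Import GRing.Theory.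
Local Open Scope ring_scope.

(* The coloured letter i^[c] is the pair (i, c), and [n] = {1, ..., n} is
   'I_n = {0, ..., n-1}.  Colours live in 'Z_r, which is the ring of integers
   mod r only for r > 1; p > 1 and p %| r with r odd make r at least 3. *)
Definition letter (r n : nat) : finType := ('I_n * 'Z_r)%type.

Definition colperm (r n : nat) : {set {perm letter r n}} :=
  [set s : {perm letter r n} | [exists t : 'S_n, [exists z : {ffun 'I_n -> 'Z_r},
     [forall i : 'I_n, [forall c : 'Z_r, s (i, c) == (t i, c + z i)]]]]].

(* |s|(i) and z_i(s) are the letter and the colour of s(i^[0]). *)
Definition absv (r n : nat) (s : {perm letter r n}) (i : 'I_n) : 'I_n :=
  (s (i, 0)).1.

Definition colour (r n : nat) (s : {perm letter r n}) (i : 'I_n) : 'Z_r :=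
  (s (i, 0)).2.

Lemma colpermE (r n : nat) (s : {perm letter r n}) (i : 'I_n) (c : 'Z_r) :
  s \in colperm r n -> s (i, c) = (absv s i, c + colour s i).
Proof.
rewrite inE => /existsP[t /existsP[z /forallP h]].
have E k d : s (k, d) = (t k, d + z k) by apply/eqP; move/forallP: (h k).
by rewrite /absv /colour !E add0r.
Qed.

(* Sum in nat of the representatives in {0, ..., r-1}, not a sum in 'Z_r. *)
Definition csum (r n : nat) (s : {perm letter r n}) : nat :=
  (\sum_(i < n) nat_of_ord (colour s i))%N.

Definition colperm_p (r p n : nat) : {set {perm letter r n}} :=
  [set s : {perm letter r n} in colperm r n | csum s == 0 %[mod p]].

Definition involutions (r p n : nat) : {set {perm letter r n}} :=
  [set s : {perm letter r n} in colperm_p r p n | (s * s)%g == 1%g].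

(* Strict colour order: larger colours come first, and letters of the same
   colour are compared by their underlying number. *)
Definition clt (r n : nat) (x y : letter r n) : bool :=
  ((y.2 : nat) < x.2)%N || (x.2 == y.2) && ((x.1 : nat) < y.1)%N.

(* i \in [n-1] reads i.+1 < n after the shift to 'I_n. *)
Definition excA (r n : nat) (s : {perm letter r n}) : nat :=
  #|[set i : 'I_n | (i.+1 < n)%N && clt (i, 0) (s (i, 0))]|.

Definition fixa (r n : nat) (s : {perm letter r n}) : nat :=
  #|[set i : 'I_n | absv s i == i]|.

(* The indeterminates u, v, w. *)
Definition U : {mpoly rat[3]} := 'X_(0 : 'I_3).
Definition V : {mpoly rat[3]} := 'X_(1 : 'I_3).
Definition W : {mpoly rat[3]} := 'X_(2%:R : 'I_3).

Definition invpoly_nat (r p n : nat) : {mpoly rat[3]} :=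
  \sum_(s in involutions r p n) U ^+ fixa s * V ^+ excA s * W ^+ csum s.

(* The index is an integer so that f_{r,p,-1} = 0 makes sense; the convention
   f_{r,p,0} = 1 is the value of the sum over the empty permutation. *)
Definition invpoly (r p : nat) (n : int) : {mpoly rat[3]} :=
  if n is Posz m then invpoly_nat r p m else 0.

Lemma invpoly0 (r p : nat) : invpoly r p 0 = 1.
Proof.
have e (a b : {perm letter r 0}) : a = b by apply/permP => -[[]].
have csum0 (s : {perm letter r 0}) : csum s = 0%N by rewrite /csum big_ord0.
have card0 (A : {set 'I_0}) : #|A| = 0%N.
  by apply/eqP; rewrite cards_eq0; apply/eqP/setP; case.
have inI (s : {perm letter r 0}) : s \in involutions r p 0.
  rewrite inE (e (s * s)%g 1%g) eqxx andbT inE csum0 eqxx andbT inE.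
  apply/existsP; exists 1%g; apply/existsP; exists [ffun=> 0].
  by apply/forallP; case.
have -> : invpoly r p 0 = invpoly_nat r p 0 by [].
rewrite /invpoly_nat (big_pred1 1%g) => [|s]; last first.
  by rewrite inI; apply/esym/eqP; apply: e.
have -> : fixa (1%g : {perm letter r 0}) = 0%N by apply: card0.
have -> : excA (1%g : {perm letter r 0}) = 0%N by apply: card0.
by rewrite csum0 !expr0 !mulr1.
Qed.

Definition multinomial (n a b c : nat) : rat :=
  n`!%:R / (a`! * b`! * c`!)%N%:R.

(* Main.v *)
Require Import Defs.
From mathcomp Require Import all_boot all_order all_fingroup all_algebra.
From mathcomp Require Import mpoly zify ring.

Set Implicit Arguments.
Unset Strict Implicit.
Unset Printing Implicit Defensive.

Import GRing.Theory Num.Theory.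
Local Open Scope ring_scope.

(* A coloured involution consists of an involution t of [n] together with
   colours satisfying z (t i) = - z i.  For odd r the colour of a fixed point
   vanishes, while a 2-cycle i < t i has weight v when z i = 0, and otherwise
   w^r, because the representatives of z i and - z i add up to r and a letter of
   nonzero colour precedes i.  Hence csum is a multiple of r, the constraint
   modulo p is void, and f is the generating function of the involutions of [n]
   with weight u per fixed point and v + (r - 1) w^r per 2-cycle. *)

Lemma perm_sqr1P (T : finType) (t : {perm T}) :
  reflect (involutive t) ((t * t)%g == 1%g).
Proof.
apply: (iffP eqP) => [tt x | tK]; first by rewrite -permM tt perm1.
by apply/permP => x; rewrite permM perm1 tK.
Qed.

(** * The two-term recurrence and its explicit solution *)

Fixpoint invrec (R : nzRingType) (u q : R) (n : nat) : R :=
  if n is m.+1 then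
    u * invrec u q m + (if m is k.+1 then m%:R * q * invrec u q k else 0)
  else 1.

Lemma invrecSS (R : nzRingType) (u q : R) n :
  invrec u q n.+2 = u * invrec u q n.+1 + n.+1%:R * q * invrec u q n.
Proof. by []. Qed.

(** The double factorial (2k-1)!!, which counts the perfect matchings of 2k points. *)
Fixpoint odd_fact (k : nat) : nat :=
  if k is j.+1 then (j.*2.+1 * odd_fact j)%N else 1%N.

Lemma odd_factE k : (odd_fact k * k`! * 2 ^ k = k.*2`!)%N.
Proof.
elim: k => [//|k IH]; rewrite doubleS !factS -IH expnS /=; lia.
Qed.

(** The coefficient counts the involutions with [k] 2-cycles: choose the 2k moved points, then match
    them. Binomials vanish beyond [n], so the bound [N] may be loose; this lets the induction use
    [N.+1] for [n.+1] and [N] for [n]. *)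
Lemma invrecE (R : comNzRingType) (u q : R) n N : (n < N.*2)%N ->
  invrec u q n =
  \sum_(k < N) ('C(n, k.*2) * odd_fact k)%:R * (u ^+ (n - k.*2) * q ^+ k).
Proof.
have [m] := ubnP n; elim: m n N => // m IH [|[|n]] [|N] // ltnm lenN.
- rewrite big_ord_recl big1 ?addr0 /= ?bin0 ?expr0 ?mulr1 // => i _.
  by rewrite bin0n mul0n mul0r.
- rewrite big_ord_recl big1 /= ?addr0 ?bin0 ?expr0 ?mulr1 ?mul1r // => i _.
  by rewrite bin_small ?mul0n ?mul0r // lift0 doubleS.
rewrite invrecSS (IH n.+1 N.+1) 1?(IH n N); try lia.
rewrite !big_ord_recl /= !bin0 !double0 !subn0 !mul1n !expr0 !mulr1 mulrDr.
rewrite mul1r -exprS mul1r -addrA; congr (_ + _).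
rewrite !mulr_sumr -big_split /=; apply: eq_bigr => k _.
rewrite /bump leq0n add1n add0n doubleS !subSS.
rewrite [in RHS]binS mulnDl natrD mulrDl; congr (_ + _).
  (* Subtraction is truncated, so the exponents of [u] are matched only in range; out of range the
     binomial is 0. *)
  have [le|lt] := leqP k.*2.+2 n.+1; last first.
    by rewrite bin_small // mul0n !mul0r mulr0.
  have -> : (n - k.*2 = (n - k.*2.+1).+1)%N by lia.
  by rewrite [u ^+ _.+1]exprS; ring.
(* The new factor [k.*2.+1] of [odd_fact] is absorbed by the binomial and yields the factor [n.+1]
   of the recurrence. *)
have -> : ('C(n.+1, k.*2.+1) * odd_fact k.+1
           = n.+1 * ('C(n, k.*2) * odd_fact k))%N.
  by rewrite /= mulnA (mulnC 'C(_, _)) -mul_bin_diag mulnA.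
by rewrite natrM exprS; ring.
Qed.

(** * Weighted involutions supported in a subset of [n] *)

Section UncolouredInvolutions.

Variables (R : comNzRingType) (u q : R) (n : nat).
Implicit Types (A : {set 'I_n}) (x y i j : 'I_n) (t : 'S_n).

(** A 2-cycle is charged to its smaller element only, so the weight of an involution is a product
    over points. *)
Definition pairwt i j : R :=
  if (i < j)%N then q else if j == i then u else 1.

(* The involutions supported in A, so that removing points needs no relabelling. *)
Definition invsum A : R :=
  \sum_(t : 'S_n | perm_on A t && ((t * t)%g == 1%g))
    \prod_(i in A) pairwt i (t i).

Lemma pairwt_swap x y : x != y -> pairwt x y * pairwt y x = q.
Proof.
move=> neq_xy; rewrite /pairwt eq_sym (negPf neq_xy).
have : (x : nat) != y by [].
by case: ltngtP => // _ _; rewrite ?mulr1 ?mul1r.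
Qed.

Lemma invsum0 : invsum set0 = 1.
Proof.
rewrite /invsum (big_pred1 1%g) => [|t]; first by rewrite big_set0.
apply/andP/eqP => [[/subsetP t0 _]|->]; last by rewrite perm_on1 mulg1.
apply/permP => i; rewrite perm1; apply/eqP/negPn/negP => ti.
by have := t0 i ti; rewrite inE.
Qed.

Lemma invsum_fixed A x : x \in A ->
  \sum_(t : 'S_n | perm_on A t && ((t * t)%g == 1%g) && (t x == x))
    \prod_(i in A) pairwt i (t i) = u * invsum (A :\ x).
Proof.
move=> Ax; rewrite mulr_sumr; apply: eq_big => t.
  have [|] := boolP ((t * t)%g == 1%g) => tt; rewrite ?andbF //= !andbT.
  apply/andP/idP => [[/subsetP tA /eqP tx]|/subsetP tA].
    apply/subsetP => i ti; rewrite !inE tA // andbT.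
    by apply: contraNneq ti => ->; rewrite /= tx.
  split; first by apply/subsetP => i /tA; rewrite !inE => /andP[].
  by apply/negPn/negP => /tA; rewrite !inE eqxx.
move=> /andP[_ /eqP tx]; rewrite (big_setD1 x) //= tx.
by rewrite {1}/pairwt ltnn eqxx.
Qed.

(** Multiplication by [tperm x y] is a bijection from the involutions supported off [x] and [y] to
    those exchanging them. *)
Lemma invsum_swapped A x y : x \in A -> y \in A -> x != y ->
  \sum_(t : 'S_n | perm_on A t && ((t * t)%g == 1%g) && (t x == y))
    \prod_(i in A) pairwt i (t i) = q * invsum (A :\ x :\ y).
Proof.
move=> Ax Ay xy.
rewrite (reindex_inj (mulgI (tperm x y))) /= mulr_sumr; apply: eq_big => t.
  apply/andP/andP => [[/andP[/subsetP sA /perm_sqr1P sK] /eqP]|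
                      [/subsetP tB /perm_sqr1P tK]].
    rewrite permM tpermL => ty.
    have tx : t x = x by have := sK x; rewrite !permM tpermL ty tpermR.
    have sE i : i != x -> i != y -> (tperm x y * t)%g i = t i.
      by move=> ix iy; rewrite permM tpermD // eq_sym.
    split.
      apply/subsetP => i ti; rewrite !inE.
      have ix : i != x by apply: contraNneq ti => ->; rewrite /= tx.
      have iy : i != y by apply: contraNneq ti => ->; rewrite /= ty.
      by rewrite ix iy sA //= inE sE.
    apply/perm_sqr1P => i.
    have [->|ix] := eqVneq i x; first by rewrite !tx.
    have [->|iy] := eqVneq i y; first by rewrite !ty.
    have := sK i; rewrite (sE i) // sE //.
      by apply: contra_neq ix => tix; apply: (@perm_inj _ t); rewrite tix tx.
    by apply: contra_neq iy => tiy; apply: (@perm_inj _ t); rewrite tiy ty.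
  have tx : t x = x.
    by apply/eqP/negPn/negP => /tB; rewrite !inE eqxx andbF.
  have ty : t y = y by apply/eqP/negPn/negP => /tB; rewrite !inE eqxx.
  split; last by rewrite permM tpermL ty.
  apply/andP; split.
    apply/subsetP => i; rewrite inE permM; case: tpermP => [->|->|ix iy] //.
    by move/tB; rewrite !inE => /and3P[].
  apply/perm_sqr1P => i; rewrite !permM.
  have [->|ix] := eqVneq i x; first by rewrite tpermL ty tpermR tx.
  have [->|iy] := eqVneq i y; first by rewrite tpermR tx tpermL ty.
  rewrite (tpermD (z := i)) 1?eq_sym // tpermD ?tK // eq_sym.
    by apply: contra_neq ix => tix; apply: (@perm_inj _ t); rewrite tix tx.
  by apply: contra_neq iy => tiy; apply: (@perm_inj _ t); rewrite tiy ty.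
move=> /andP[/andP[_ /perm_sqr1P sK] /eqP sx].
have sy : (tperm x y * t)%g y = x by rewrite -{2}sx sK.
rewrite (big_setD1 x) //= sx (big_setD1 y) /=; last by rewrite !inE eq_sym xy.
rewrite sy mulrA pairwt_swap //; congr (_ * _); apply: eq_bigr => i.
by rewrite !inE => /and3P[iy ix _]; rewrite permM tpermD // eq_sym.
Qed.

(** Induction on the cardinality: pick [x] in [A] and classify the involutions by the image of [x],
    which is [x] itself or one of the [#|A| - 1] other points. *)
Lemma invsumE A : invsum A = invrec u q #|A|.
Proof.
have [m] := ubnP #|A|; elim: m A => // m IH A ltAm.
have [->|[x Ax]] := set_0Vmem A; first by rewrite invsum0 cards0.
have cA := cardsD1 x A; rewrite Ax add1n in cA.
rewrite /invsum (partition_big (fun t : 'S_n => t x) (fun y => y \in A)) /=;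
  last by move=> t /andP[tA _]; rewrite perm_closed.
rewrite (big_setD1 x) //= invsum_fixed // IH; last by rewrite -ltnS -cA.
rewrite cA /=; congr (_ + _).
under eq_bigr => y /setD1P[yx Ay] do rewrite invsum_swapped // 1?eq_sym //.
case E: #|A :\ x| => [|k].
  by rewrite big1 // => y yA; move: (card0_eq E y); rewrite yA.
rewrite (eq_bigr (fun=> q * invrec u q k)) => [|y yA].
  by rewrite sumr_const E -mulrA mulr_natl.
have := cardsD1 y (A :\ x); rewrite yA add1n E => -[Ek].
by rewrite IH -Ek //; move: ltAm; rewrite cA E ltnS => /ltnW.
Qed.

End UncolouredInvolutions.

(** Reindexing by [t] moves the terms at the larger elements of the 2-cycles to the smaller ones. *)
Lemma big_involution (R : Type) (idx : R) (op : Monoid.com_law idx) (n : nat)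
    (t : 'S_n) (F : 'I_n -> R) : involutive t ->
  \big[op/idx]_(i < n) F i =
  \big[op/idx]_(i < n) (if (i < t i)%N then op (F i) (F (t i))
                  else if t i == i then F i else idx).
Proof.
move=> tK; rewrite (bigID (fun i : 'I_n => (i < t i)%N)) /=.
rewrite [X in op _ X](bigID (fun i : 'I_n => t i == i)) /=.
rewrite [RHS](bigID (fun i : 'I_n => (i < t i)%N)) /=.
rewrite [X in _ = op _ X](bigID (fun i : 'I_n => t i == i)) /=.
rewrite [X in _ = op _ (op _ X)]big1 ?Monoid.mulm1; last first.
  by move=> i /andP[/negPf-> /negPf->].
rewrite [X in _ = op X _](eq_bigr (fun i => op (F i) (F (t i))));
  last by move=> i ->.
rewrite big_split /= -Monoid.mulmA; congr (op _ _).
rewrite Monoid.mulmC; congr (op _ _); last first.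
  by apply: eq_bigr => i /andP[/negPf-> ->].
rewrite (reindex_inj (@perm_inj _ t)) /=; apply: eq_bigl => i.
by rewrite tK -leqNgt [RHS]ltn_neqAle andbC.
Qed.

(** * Coloured involutions and the summation over colours *)

Section Colours.

Variable r : nat.
Hypothesis r_gt1 : (1 < r)%N.

Lemma Zp_add_opp_nat (z : 'Z_r) :
  (nat_of_ord z + nat_of_ord (- z) = if z == 0%R then 0 else r)%N.
Proof.
rewrite -val_eqE /=; case: z => z /=; rewrite Zp_cast // => zr.
by have [->|z0] := eqVneq z 0%N; [rewrite subn0 modnn | rewrite modn_small; lia].
Qed.

(** Otherwise the representative of [z], doubled, would equal the odd number [r]. *)
Lemma Zp_opp_fixed (z : 'Z_r) : odd r -> z = - z -> z = 0.
Proof.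
move=> r_odd zN; have := Zp_add_opp_nat z; rewrite -zN; case: eqP => // _ zr.
by have := odd_double z; rewrite -addnn zr r_odd.
Qed.

Variable n : nat.
Implicit Types (x : 'S_n * {ffun 'I_n -> 'Z_r}) (t : 'S_n).

Lemma colfun_inj x :
  injective (fun y : letter r n => (x.1 y.1, y.2 + x.2 y.1) : letter r n).
Proof.
move=> [i c] [j d] e; have /perm_inj ij := congr1 fst e.
by have := congr1 snd e; rewrite /= (ij : i = j) => /addIr ->.
Qed.

(** Pairs of an underlying permutation and a colour vector serve as coordinates on the coloured
    permutations. *)
Definition mkcol x : {perm letter r n} := perm (@colfun_inj x).

Lemma mkcolE x i c : mkcol x (i, c) = (x.1 i, c + x.2 i).
Proof. by rewrite permE. Qed.

Lemma mkcol_inj : injective mkcol.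
Proof.
move=> [t z] [t' z'] /permP E; congr (_, _).
  by apply/permP => i; have := congr1 fst (E (i, 0)); rewrite !mkcolE.
by apply/ffunP => i; have := congr1 snd (E (i, 0)); rewrite !mkcolE /= !add0r.
Qed.

Lemma absv_mkcol x i : absv (mkcol x) i = x.1 i.
Proof. by rewrite /absv mkcolE. Qed.

Lemma colour_mkcol x i : colour (mkcol x) i = x.2 i.
Proof. by rewrite /colour mkcolE add0r. Qed.

Definition opposite_colours t (z : {ffun 'I_n -> 'Z_r}) : bool :=
  [forall i, z (t i) == - z i].

Lemma mkcol_sqr1 x :
  ((mkcol x * mkcol x)%g == 1%g) =
  ((x.1 * x.1)%g == 1%g) && opposite_colours x.1 x.2.
Proof.
apply/perm_sqr1P/andP => [sK|[/perm_sqr1P tK /forallP zN] [i c]].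
  have E i : (x.1 (x.1 i), x.2 i + x.2 (x.1 i)) = (i, 0 : 'Z_r).
    by rewrite -(sK (i, 0)) !mkcolE add0r.
  split; first by apply/perm_sqr1P => i; exact: (congr1 fst (E i)).
  by apply/forallP => i; rewrite -addr_eq0 addrC; apply/eqP/(congr1 snd (E i)).
by rewrite !mkcolE tK (eqP (zN i)) addrK.
Qed.

Hypothesis r_odd : odd r.

Lemma opposite_colours_fixed t z i :
  opposite_colours t z -> t i = i -> z i = 0.
Proof.
by move=> /forallP/(_ i)/eqP zi ti; apply: Zp_opp_fixed => //; rewrite -zi ti.
Qed.

Lemma csum_mkcol x : ((x.1 * x.1)%g == 1%g) -> opposite_colours x.1 x.2 ->
  csum (mkcol x) =
  (\sum_(i < n) (if (i < x.1 i)%N && (x.2 i != 0%R) then r else 0))%N.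
Proof.
move=> /perm_sqr1P tK zN; rewrite /csum (big_involution _ _ tK) /=.
apply: eq_bigr => i _; rewrite !colour_mkcol.
case: ifP => [_|_] /=.
  by rewrite (eqP (forallP zN i)) Zp_add_opp_nat; case: eqP.
by case: eqP => // /(opposite_colours_fixed zN) ->.
Qed.

Lemma involutionsE p : (p %| r)%N ->
  involutions r p n =
  mkcol @: [set x | ((x.1 * x.1)%g == 1%g) && opposite_colours x.1 x.2].
Proof.
move=> p_r; apply/setP => s; apply/idP/imsetP => [|[x]].
  rewrite !inE => /andP[/andP[/existsP[t /existsP[z /forallP sE]] _] ss].
  have Es : s = mkcol (t, z).
    apply/permP => -[i c]; rewrite mkcolE.
    by apply/eqP; move/forallP: (sE i).
  by exists (t, z) => //; rewrite inE -mkcol_sqr1 -Es.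
rewrite inE => xP ->; rewrite !inE mkcol_sqr1 xP andbT; apply/andP; split.
  apply/existsP; exists x.1; apply/existsP; exists x.2.
  by apply/forallP => i; apply/forallP => c; rewrite mkcolE.
have /andP[tt zN] := xP; rewrite csum_mkcol // mod0n.
by apply: dvdn_sum => i _; case: ifP.
Qed.

Definition colwt t (i : 'I_n) (c : 'Z_r) : {mpoly rat[3]} :=
  if (i < t i)%N then (if c == 0 then V else W ^+ r)
  else if t i == i then U else 1.

Lemma weight_mkcol x : ((x.1 * x.1)%g == 1%g) -> opposite_colours x.1 x.2 ->
  U ^+ fixa (mkcol x) * V ^+ excA (mkcol x) * W ^+ csum (mkcol x) =
  \prod_i colwt x.1 i (x.2 i).
Proof.
move=> tt zN; rewrite csum_mkcol //.
have -> : fixa (mkcol x) = (\sum_i (x.1 i == i : nat))%N.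
  rewrite /fixa -sum1_card big_mkcond; apply: eq_bigr => i _.
  by rewrite inE absv_mkcol; case: eqP.
have -> : excA (mkcol x) =
    (\sum_(i < n) ((i < x.1 i)%N && (x.2 i == 0%R) : nat))%N.
  rewrite /excA -sum1_card big_mkcond; apply: eq_bigr => i _.
  rewrite inE /clt mkcolE add0r /= [0 == _]eq_sym [(_ == _) && _]andbC.
  have [lt|] := boolP (i < x.1 i)%N; last by rewrite andbF.
  (* The condition [i.+1 < n] follows from [i < x.1 i < n]; a nonzero colour at [i] rules out an
     excedance. *)
  by rewrite (leq_ltn_trans lt (ltn_ord _)) /=; case: eqP.
rewrite -!prodrXr -!big_split /=; apply: eq_bigr => i _.
rewrite /colwt; have [->|ne] := eqVneq (x.1 i) i.
  by rewrite ltnn /= !expr0 !mulr1.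
by case: (i < _)%N; case: (x.2 i == 0); rewrite /= !expr0 ?mulr1 ?mul1r.
Qed.

(** The two colours on a 2-cycle determine each other, so the sum is first rewritten over
    independent colours, [ext] restoring the opposite ones; it then factors over the points. *)
Lemma sum_colwt t :
  ((t * t)%g == 1%g) ->
  \sum_(z | opposite_colours t z) \prod_i colwt t i (z i) =
  \prod_i pairwt U (V + (r%:R - 1) * W ^+ r) i (t i).
Proof.
move=> /perm_sqr1P tK.
pose Q (i : 'I_n) : pred 'Z_r := fun c => (i < t i)%N || (c == 0).
(* The colours on the smaller elements of the 2-cycles are free. *)
pose ext (f : {ffun 'I_n -> 'Z_r}) : {ffun 'I_n -> 'Z_r} :=
  [ffun i : 'I_n => if (i < t i)%N then f i else if (t i < i)%N then - f (t i) else 0].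
pose res (z : {ffun 'I_n -> 'Z_r}) : {ffun 'I_n -> 'Z_r} :=
  [ffun i : 'I_n => if (i < t i)%N then z i else 0].
rewrite (reindex_onto ext res) => [|z zN]; last first.
  apply/ffunP => i; rewrite !ffunE tK; case: ltngtP => // [lt|/val_inj ti].
    by rewrite (eqP (forallP zN i)) opprK.
  by rewrite (opposite_colours_fixed zN).
rewrite (eq_bigl (fun f => f \in family Q)) => [|f]; last first.
  apply/andP/familyP => [[_ /eqP fE] i|fQ].
    by rewrite -fE unfold_in !ffunE; case: (i < t i)%N.
  split; last first.
    apply/eqP/ffunP => i; rewrite !ffunE.
    by have := fQ i; rewrite unfold_in; case: (i < t i)%N => //= /eqP.
  apply/forallP => i; rewrite !ffunE tK.
  by case: ltngtP; rewrite ?opprK ?oppr0.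
(* [colwt] ignores the colour unless [i < t i], where [ext f] and [f] agree. *)
transitivity (\sum_(f in family Q) \prod_i colwt t i (f i)).
  apply: eq_bigr => f _; apply: eq_bigr => i _.
  by rewrite /colwt ffunE; case: (i < t i)%N.
rewrite -bigA_distr_big_dep; apply: eq_bigr => i _.
rewrite /Q /colwt /pairwt; case: (i < t i)%N => /=; last by rewrite big_pred1_eq.
(* Colour 0 contributes [V], each of the r - 1 other colours [W ^+ r]. *)
rewrite (bigD1 0) //=; congr (_ + _).
rewrite (eq_bigr (fun=> W ^+ r)) => [|c /negPf-> //].
rewrite sumr_const cardC1 card_ord Zp_cast // -[X in X = _]mulr_natl.
by rewrite /= -subn1 natrB // ltnW.
Qed.

Lemma invpoly_natE p : (p %| r)%N ->
  invpoly_nat r p n = invrec U (V + (r%:R - 1) * W ^+ r) n.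
Proof.
move=> p_r; rewrite /invpoly_nat involutionsE // big_imset /=; last first.
  by move=> ? ? _ _ /mkcol_inj.
transitivity (\sum_(t : 'S_n | (t * t)%g == 1%g)
    \sum_(z | opposite_colours t z) \prod_i colwt t i (z i)).
  rewrite pair_big_dep /=; apply: eq_big => [x|x]; rewrite inE // => /andP[? ?].
  exact: weight_mkcol.
rewrite -[in RHS](card_ord n) -cardsT -invsumE; apply: eq_big => [t|t tt].
  by rewrite andb_idl // => _; apply/subsetP.
rewrite sum_colwt //; by apply: eq_bigl => i; rewrite inE.
Qed.

End Colours.

(** * Matching the coefficients, and the two formulas for f *)

Lemma involution_coef n k : (k.*2 <= n)%N ->
  k`!%:R * multinomial n k k (n - k.*2) / 2%:R ^+ k
  = ('C(n, k.*2) * odd_fact k)%:R :> rat.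
Proof.
move=> le_kn.
have fact_neq0 m : m`!%:R != 0 :> rat by rewrite pnatr_eq0 -lt0n fact_gt0.
(* Both sides become comparable through n! = C(n,2k) (2k)! (n-2k)! and (2k)! = (2k-1)!! k! 2^k. *)
rewrite /multinomial -(bin_fact le_kn) -odd_factE !natrM natrX.
by field; rewrite !fact_neq0 expf_neq0.
Qed.

Theorem corollary5p5 (r p : nat) (hr : odd r) (hp : (1 < p)%N)
    (hpr : (p %| r)%N) (n : nat) (hn : (1 <= n)%N) :
  (invpoly r p n%:Z =
     U * invpoly r p (n%:Z - 1)
     + (n%:R - 1) * (V + (r%:R - 1) * W ^+ r) * invpoly r p (n%:Z - 2))
  /\
  (invpoly r p n%:Z =
     \sum_(uphalf n <= j < n.+1)
       ((n - j)`!%:R * multinomial n (n - j) (n - j) (2 * j - n)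
          / 2%:R ^+ (n - j)) *:
       (U ^+ (2 * j - n) * (V + (r%:R - 1) * W ^+ r) ^+ (n - j))).
Proof.
have r_gt1 : (1 < r)%N by apply: leq_trans hp (dvdn_leq (odd_gt0 hr) hpr).
have fE m : invpoly r p m%:Z = invrec U (V + (r%:R - 1) * W ^+ r) m.
  exact: invpoly_natE.
split.
  case: n hn => [//|[|n]] _.
    (* For n = 1 the last index is -1, where [invpoly] is 0 by convention. *)
    by rewrite (_ : 1%:Z - 1 = 0%N) // (_ : 1%:Z - 2 = -1) // !fE /= mulr0.
  have -> : n.+2%:Z - 1 = n.+1%:Z by lia.
  have -> : n.+2%:Z - 2 = n%:Z by lia.
  by rewrite !fE invrecSS -[n.+2]addn1 natrD addrK.
rewrite fE (@invrecE _ _ _ n (n./2).+1); last by lia.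
rewrite -[uphalf n]add0n big_addn.
have -> : (n.+1 - uphalf n = n./2.+1)%N by lia.
(* Reversing the sum makes the number of 2-cycles k = n - j the summation index. *)
rewrite [RHS]big_nat_rev big_mkord; apply: eq_bigr => k _ /=.
have le_kn : (k.*2 <= n)%N by have := ltn_ord k; lia.
have -> : (n - (0 + n./2.+1 - k.+1 + uphalf n) = k)%N by lia.
have -> : (2 * (0 + n./2.+1 - k.+1 + uphalf n) - n = n - k.*2)%N by lia.
by rewrite involution_coef // scaler_nat mulr_natl.
Qed.
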